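(* For any independent real random variables $Y_1,\dots,Y_n$ with $\|Y_i\|_{\psi_1}<\infty$, any $t\ge0$, and any non-random weight $\boldsymbol{w}=(w_1,\dots,w_n)^\top$, $$\mathrm{P}\Big(\Big|\sum_{i=1}^nw_i(Y_i-\mathrm{E}Y_i)\Big|\ge t\Big)\le2\exp\left\{-\frac14\left(\frac{t^2}{2\sum_{i=1}^nw_i^2\big(\|Y_i\|_{\psi_1}+|\mathrm{E}Y_i/\log2|\big)^2}\wedge\frac{t}{\max_{1\le i\le n}|w_i|\big(\|Y_i\|_{\psi_1}+|\mathrm{E}Y_i/\log2|\big)}\right)\right\},$$ and $$\mathrm{P}\left(\Big|\sum_{i=1}^nw_i(Y_i-\mathrm{E}Y_i)\Big|>2\Big(2t\sum_{i=1}^nw_i^2\|Y_i-\mathrm{E}Y_i\|_{\psi_1}^2\Big)^{1/2}+2t\max_{1\le i\le n}\big(|w_i|\,\|Y_i-\mathrm{E}Y_i\|_{\psi_1}\big)\right)\le2e^{-t}.$$ In particular, if the $Y_i$ are independently distributed as $\operatorname{NB}(\mu_i,k_i)$, then $$\mathrm{P}\Big(\Big|\sum_{i=1}^nw_i(Y_i-\mathrm{E}Y_i)\Big|\ge t\Big)\le2\exp\left\{-\frac14\left(\frac{t^2}{2\sum_{i=1}^nw_i^2a^2(\mu_i,k_i)}\wedge\frac{t}{\max_{1\le i\le n}|w_i|a(\mu_i,k_i)}\right)\right\},$$ where $$a(\mu_i,k_i):=\left[\log\frac{1-(1-q_i)/\sqrt[k_i]{2}}{q_i}\right]^{-1}+\frac{\mu_i}{\log2},\qquad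 q_i:=\frac{\mu_i}{k_i+\mu_i}.$$
   Context: $\|X\|_{\psi_1}:=\inf\{C>0:\mathrm{E}\exp(|X|/C)\le2\}$. $\operatorname{NB}(\mu_i,k_i)$, with mean $\mu_i>0$ and parameter $k_i\in(0,\infty)$, is the negative binomial distribution with $\mathrm{P}(Y_i=y)=\frac{\Gamma(y+k_i)}{\Gamma(k_i)y!}(1-q_i)^{k_i}q_i^y$, $y\in\mathbb{N}=\{0,1,2,\dots\}$, $q_i\in(0,1)$, whose mean is $\mu_i=k_iq_i/(1-q_i)$. $\sqrt[k]{2}=2^{1/k}$ and $x\wedge y=\min(x,y)$. *)

(* Defs.v *)
From HB Require Import structures.
From mathcomp Require Import all_boot all_order all_algebra.
From mathcomp Require Import all_classical all_reals all_analysis.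
Import Order.TTheory GRing.Theory Num.Theory numFieldNormedType.Exports.

Set Implicit Arguments.
Unset Strict Implicit.
Unset Printing Implicit Defensive.

Local Open Scope classical_set_scope.
Local Open Scope ring_scope.

Section definitions.
Context {d : measure_display} {T : measurableType d} {R : realType}.
Variable P : probability T R.

Definition mutually_independent {I : finType} (Y : I -> {RV P >-> R}) : Prop :=
  forall (J : {set I}) (B : I -> set R),
    (forall i, measurable (B i)) ->
    P (\bigcap_(i in [set` J]) (Y i @^-1` B i)) =
      (\prod_(i in J) P (Y i @^-1` B i))%E.

(* Extended-real valued: it is +oo when no admissible C exists. *)
Definition psi1_norm (X : T -> R) : \bar R :=
  ereal_inf [set C%:E | C in [set C : R |
    0 < C /\ ('E_P[fun x => expR (`|X x| / C)] <= 2%:E)%E]].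

(* Real-valued mean; [fine] is harmless as soon as X is integrable, in
   particular when its psi_1 norm is finite. *)
Definition mean (X : T -> R) : R := fine ('E_P[X])%E.

Definition centered (X : T -> R) : T -> R := fun x => X x - mean X.

Definition weighted_centered_sum {n : nat} (w : 'I_n -> R)
    (Y : 'I_n -> {RV P >-> R}) : T -> R :=
  fun x => \sum_(i < n) w i * (Y i x - mean (Y i)).

End definitions.

Section bounds.
Context {R : realType}.

(* All the maxima taken below are over nonnegative families, so that 0 is a
   neutral default value. *)
Definition max_weighted {n : nat} (w K : 'I_n -> R) : R :=
  \big[Num.max/0]_(i < n) (`|w i| * K i).

Definition sum_weighted_sq {n : nat} (w K : 'I_n -> R) : R :=
  \sum_(i < n) w i ^+ 2 * K i ^+ 2.

(* 2 exp(- (1/4) (t^2 / (2 sum_i w_i^2 K_i^2) /\ t / max_i |w_i| K_i)).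
   The quotients are taken in the extended reals, where 0^-1 = +oo and
   0 * +oo = 0: when the denominators vanish the bound is 0 for t > 0 and
   2 for t = 0, whereas the division of R would make it vacuous. *)
Definition bernstein_bound {n : nat} (w K : 'I_n -> R) (t : R) : \bar R :=
  (2%:E * expeR (- ((4^-1)%:E *
     mine ((t ^+ 2)%:E / (2 * sum_weighted_sq w K)%:E)
          (t%:E / (max_weighted w K)%:E))))%E.

End bounds.

Section negative_binomial.
Context {R : realType}.

Definition Gamma (x : R) : R :=
  \int[@lebesgue_measure R]_(s in `]0, +oo[) (s `^ (x - 1) * expR (- s)).

Definition nb_q (mu k : R) : R := mu / (k + mu).

Definition nb_pmf (mu k : R) (y : nat) : R :=
  Gamma (y%:R + k) / (Gamma k * y`!%:R) * (1 - nb_q mu k) `^ k * nb_q mu k ^+ y.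

(* Since these masses sum to 1, this determines the law of X. *)
Definition has_NB_law {d : measure_display} {T : measurableType d}
    (P : probability T R) (X : {RV P >-> R}) (mu k : R) : Prop :=
  forall y : nat, P (X @^-1` [set y%:R]) = (nb_pmf mu k y)%:E.

Definition nb_a (mu k : R) : R :=
  (ln ((1 - (1 - nb_q mu k) / 2 `^ k^-1) / nb_q mu k))^-1 + mu / ln 2.

End negative_binomial.

(* Main.v *)
Require Import Defs.
From HB Require Import structures.
From mathcomp Require Import all_boot all_order all_algebra.
From mathcomp Require Import all_classical all_reals all_analysis.
From mathcomp Require Import measurable_realfun.
From mathcomp Require Import ring lra.
Import Order.TTheory GRing.Theory Num.Theory numFieldNormedType.Exports.
Local Open Scope classical_set_scope.
Local Open Scope ring_scope.

(* The psi_1 norm controls moment generating functions: if E exp(|X|/K) <= 2 and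
   E X = 0, the pointwise bound exp(a u) <= 1 + a u + a^2 (exp u - 1), valid for
   u >= 0 and |a| <= 1, gives E exp(s X) <= 1 + s^2 K^2 <= exp(s^2 K^2) as soon
   as |s| K <= 1.  By independence and Chernoff, S = sum_i w_i (Y_i - E Y_i)
   satisfies P(|S| >= x) <= 2 exp(s^2 V - s x) for 0 < s < 1/M, where
   V = sum_i w_i^2 K_i^2 and M = max_i |w_i| K_i, and both bounds come from a
   choice of s.  The triangle inequality for the psi_1 norm bounds the norm of
   Y_i - E Y_i by that of Y_i plus |E Y_i| / ln 2.

   For the negative binomial law, the masses are mixed Poisson: exchanging the
   sum over y with the integral defining Gamma (y + k) sums the generating
   series to ((1 - q) / (1 - q a))^k.  It equals 2 at a = exp(1/C), C the first
   summand of nb_a, and its derivative at a = 1 is the mean. *)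

Set Implicit Arguments.
Unset Strict Implicit.

(** The power series are compared termwise: for i >= 2, (a u)^i <= a^2 u^i because |a| <= 1. The
    surplus a^2 u, from the linear term of exp u, is dropped. *)
Lemma expR_le_quad (R : realType) (a u : R) : 0 <= u -> `|a| <= 1 ->
  expR (a * u) <= 1 + a * u + a ^+ 2 * (expR u - 1).
Proof.
move=> u0 a1.
have cu := is_cvg_series_exp_coeff u.
have cg : 1 + a * u + a ^+ 2 * (series (exp_coeff u) n - 1) @[n --> \oo] -->
    1 + a * u + a ^+ 2 * (expR u - 1).
  by apply: cvgD; [exact: cvg_cst|apply: cvgMl_tmp; apply: cvgB => //; exact: cvg_cst].
have := is_cvg_series_exp_coeff (a * u); move=> /ler_cvg_to -/(_ _ _ cg); apply.
near=> n.
have : (1 < n)%N by near: n; exact: nbhs_infty_gt.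
move: (n) => [|[|m]] // _.
rewrite /series/= !big_nat_recl//= /exp_coeff/= !expr0 !fact0 !expr1 !divr1.
rewrite (addrC 1 (u + _)) addrK mulrDr [leLHS]addrA lerD2l.
have H : \sum_(0 <= i < m) (a * u) ^+ i.+2 / i.+2`!%:R <=
  a ^+ 2 * \sum_(0 <= i < m) u ^+ i.+2 / i.+2`!%:R.
  rewrite mulr_sumr; apply: ler_sum => i _.
  rewrite exprMn mulrA ler_wpM2r ?invr_ge0// ler_wpM2r ?exprn_ge0//.
  rewrite (le_trans (ler_norm _))// normrX -addn2 exprD real_normK ?num_real//.
  by rewrite ler_piMl ?sqr_ge0// exprn_ile1.
by rewrite (le_trans H)// lerDr mulr_ge0 ?sqr_ge0.
Unshelve. all: by end_near. Qed.

(** * The psi_1 norm *)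

Section psi1.
Context {d : measure_display} {T : measurableType d} {R : realType}.
Variable P : probability T R.
Implicit Types (X : T -> R) (C K s : R).

Local Notation moment X C := (\int[P]_x (expR (`|X x| / C))%:E)%E.

Lemma integral_probability_cst (c : R) : (\int[P]_x c%:E = c%:E)%E.
Proof. by have := expectation_cst P c; rewrite unlock. Qed.

Lemma measurable_expR_normr X C : measurable_fun setT X ->
  measurable_fun setT (fun x => expR (`|X x| / C)).
Proof.
move=> mX; apply: measurableT_comp => //; apply: measurable_funM => //.
exact: measurableT_comp.
Qed.

Lemma expR_normr_integrable X C : measurable_fun setT X ->
  (moment X C <= 2%:E)%E ->
  P.-integrable setT (fun x => (expR (`|X x| / C))%:E).
Proof.
move=> mX h; apply/integrableP; split.
  exact/measurable_EFinP/measurable_expR_normr.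
under eq_integral do rewrite gee0_abs ?lee_fin ?expR_ge0//.
by rewrite (le_lt_trans h)// ltry.
Qed.

(** Domination by C exp(|X| / C), from 1 + u <= exp u. *)
Lemma psi1_integrable X C : measurable_fun setT X -> 0 < C ->
  (moment X C <= 2%:E)%E -> P.-integrable setT (EFin \o X).
Proof.
move=> mX C0 h.
have := integrableZl measurableT C (expR_normr_integrable mX h).
apply: le_integrable => //; first exact/measurable_EFinP.
move=> x _ /=; rewrite lee_fin [leRHS]ger0_norm; last first.
  by rewrite mulr_ge0 ?expR_ge0 ?ltW.
rewrite -ler_pdivrMl// mulrC (le_trans _ (expR_ge1Dx _))//.
by rewrite lerDr.
Qed.

(** Some admissible constant lies strictly below [C], and the moment decreases as the constant
    grows. *)
Lemma psi1_moment X K C : measurable_fun setT X ->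
  (psi1_norm P X <= K%:E)%E -> K < C -> 0 < C /\ (moment X C <= 2%:E)%E.
Proof.
move=> mX XK KC.
have /ereal_inf_lt[_ [B [B0 hB] <-]] : (psi1_norm P X < C%:E)%E.
  by rewrite (le_lt_trans XK)// lte_fin.
rewrite lte_fin => BC; have C0 := lt_trans B0 BC; split => //.
rewrite unlock in hB; apply: le_trans hB; apply: ge0_le_integral => //.
- exact/measurable_EFinP/measurable_expR_normr.
- exact/measurable_EFinP/measurable_expR_normr.
- move=> x _; rewrite lee_fin ler_expR; apply: ler_wpM2l => //; rewrite lef_pV2 ?posrE//.
  exact: ltW.
Qed.

Lemma psi1_norm_ge0 X : (0 <= psi1_norm P X)%E.
Proof. by apply/ereal_infP => _ [C [C0 _] <-]; rewrite lee_fin ltW. Qed.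

Lemma psi1_le X C : 0 < C -> (moment X C <= 2%:E)%E ->
  (psi1_norm P X <= C%:E)%E.
Proof. by move=> C0 h; apply: ereal_inf_lbound; exists C => //; split => //; rewrite unlock. Qed.

(* Convexity of the exponential at the weight K / C, C = K + |m| / ln 2, is the
   triangle inequality in disguise: the constant m has norm |m| / ln 2. *)
Lemma moment_shift X (m : R) K : measurable_fun setT X -> 0 < K ->
  (moment X K <= 2%:E)%E ->
  (moment (fun x => X x - m) (K + `|m / ln 2|) <= 2%:E)%E.
Proof.
move=> mX K0 h.
have l2 : 0 < ln (2 : R) by rewrite ln_gt0// ltr1n.
set C := K + _.
have C0 : 0 < C by rewrite ltr_pwDl.
have a0 : 0 <= K / C by rewrite divr_ge0 ?ltW.
have a1 : 0 <= 1 - K / C by rewrite subr_ge0 ler_pdivrMr// mul1r lerDl.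
have mXm : measurable_fun setT (fun x => X x - m) by exact: measurable_funB.
have pt x : expR (`|X x - m| / C) <=
    K / C * expR (`|X x| / K) + (1 - K / C) * 2.
  (* The weight [1 - K / C] equals (|m| / ln 2) / C, so averaging |X x| / K and [ln 2] gives (|X x|
     + |m|) / C. Since exp(ln 2) = 2, the averaged moment stays at most 2. *)
  have h1 : `|X x - m| / C <= K / C * (`|X x| / K) + (1 - K / C) * ln 2.
    have -> : 1 - K / C = `|m| / ln 2 / C.
      rewrite -[X in X - _](@divff _ C) ?gt_eqF// -mulrBl /C addrAC subrr add0r.
      by rewrite normrM normfV (gtr0_norm l2).
    have -> : K / C * (`|X x| / K) + `|m| / ln 2 / C * ln 2 = (`|X x| + `|m|) / C.
      by field; rewrite !gt_eqF.
    by rewrite ler_pM2r ?invr_gt0// ler_normB.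
  apply: (le_trans (y := expR (K / C * (`|X x| / K) + (1 - K / C) * ln 2))).
    by rewrite ler_expR.
  pose a : {i01 R} := Itv01 a0 (ltac:(by rewrite -subr_ge0)).
  have := convex_expR a (`|X x| / K) (ln 2).
  by rewrite !convRE/= lnK ?posrE//.
have ih := expR_normr_integrable mX h.
apply: (@le_trans _ _ (\int[P]_x
    ((K / C)%:E * (expR (`|X x| / K))%:E + ((1 - K / C) * 2)%:E))%E).
  apply: ge0_le_integral => //.
  - exact/measurable_EFinP/measurable_expR_normr.
  - apply: emeasurable_funD => //; apply: measurable_funeM.
    exact/measurable_EFinP/measurable_expR_normr.
  - by move=> x _; rewrite -EFinM -EFinD lee_fin.
rewrite ge0_integralD//.
- rewrite ge0_integralZl//.
  + rewrite integral_probability_cst.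
    apply: (@le_trans _ _ ((K / C)%:E * 2%:E + ((1 - K / C) * 2)%:E)%E).
      by rewrite leeD2r// lee_wpmul2l.
    by rewrite -EFinM -EFinD -mulrDl addrC subrK mul1r.
  + exact/measurable_EFinP/measurable_expR_normr.
- by move=> x _; rewrite mule_ge0// lee_fin.
- by apply: measurable_funeM; exact/measurable_EFinP/measurable_expR_normr.
- by move=> x _; rewrite lee_fin mulr_ge0.
Qed.

Lemma mgf_le_expR_sqr X C s : measurable_fun setT X -> 0 < C ->
  (moment X C <= 2%:E)%E -> (\int[P]_x (X x)%:E = 0)%E -> `|s| * C <= 1 ->
  (\int[P]_x (expR (s * X x))%:E <= (expR (s ^+ 2 * C ^+ 2))%:E)%E.
Proof.
move=> mX C0 h X0 sC.
have pt x : expR (s * X x) <=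
    s ^+ 2 * C ^+ 2 * expR (`|X x| / C) + (s * X x + (1 - s ^+ 2 * C ^+ 2)).
  have u0 : 0 <= `|X x| / C by rewrite divr_ge0// ltW.
  (* The coefficient is s C times the sign of [X x], so that a u = s X x although u only sees |X
     x|. *)
  have aux a : a = s * C \/ a = - (s * C) -> a * (`|X x| / C) = s * X x ->
      expR (s * X x) <= s ^+ 2 * C ^+ 2 * expR (`|X x| / C) + (s * X x + (1 - s ^+ 2 * C ^+ 2)).
    move=> aE <-; have a2 : a ^+ 2 = s ^+ 2 * C ^+ 2.
      by case: aE => ->; rewrite ?sqrrN exprMn.
    have a1 : `|a| <= 1.
      by case: aE => ->; rewrite ?normrN normrM (gtr0_norm C0).
    apply: le_trans (expR_le_quad u0 a1) _; rewrite a2.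
    by lra.
  have [X0x|X0x] := leP 0 (X x).
    by apply: (aux (s * C)); [left|rewrite ger0_norm//; field; rewrite gt_eqF].
  by apply: (aux (- (s * C))); [right|rewrite ltr0_norm//; field; rewrite gt_eqF].
have iX := psi1_integrable mX C0 h.
have iE := expR_normr_integrable mX h.
have i1 : P.-integrable setT (fun x => (s ^+ 2 * C ^+ 2)%:E * (expR (`|X x| / C))%:E)%E.
  exact: integrableZl.
have i2 : P.-integrable setT (fun x => s%:E * (X x)%:E)%E.
  exact: integrableZl.
have i3 : P.-integrable setT (fun x : T => (1 - s ^+ 2 * C ^+ 2)%:E).
  exact: finite_measure_integrable_cst.
have i23 := integrableD measurableT i2 i3.
apply: (@le_trans _ _ (\int[P]_x ((s ^+ 2 * C ^+ 2)%:E * (expR (`|X x| / C))%:E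
    + (s%:E * (X x)%:E + (1 - s ^+ 2 * C ^+ 2)%:E)))%E).
  apply: ge0_le_integral => //.
  - by apply/measurable_EFinP; apply: measurableT_comp => //; exact: measurable_funM.
  - exact: measurable_int (integrableD measurableT i1 i23).
  - by move=> x _; rewrite -!EFinM -!EFinD lee_fin.
(* The zero mean removes the linear term; the moment bound 2 then leaves 1 + s^2 C^2. *)
rewrite integralD// integralD// !integralZl// X0 mule0 add0e integral_probability_cst.
apply: (@le_trans _ _ ((s ^+ 2 * C ^+ 2)%:E * 2%:E + (1 - s ^+ 2 * C ^+ 2)%:E)%E).
  by rewrite leeD2r// lee_wpmul2l// lee_fin mulr_ge0 ?sqr_ge0.
rewrite -EFinM -EFinD lee_fin (le_trans _ (expR_ge1Dx _))//.
by lra.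
Qed.

Lemma measurable_centered X : measurable_fun setT X ->
  measurable_fun setT (centered P X).
Proof. by move=> mX; apply: measurable_funB. Qed.

Lemma integral_centered X : P.-integrable setT (EFin \o X) ->
  (\int[P]_x (centered P X x)%:E = 0)%E.
Proof.
move=> iX; rewrite (_ : (fun x => _) = (EFin \o X \- cst (mean P X)%:E)%E)//.
rewrite integralB//; last exact: finite_measure_integrable_cst.
rewrite integral_probability_cst /mean unlock fineK ?subee//.
  exact: integrable_fin_num.
exact: integrable_fin_num.
Qed.

Lemma psi1_norm_integrable X : measurable_fun setT X ->
  (psi1_norm P X < +oo)%E -> P.-integrable setT (EFin \o X).
Proof.
move=> mX; have := psi1_norm_ge0 X.
case E : (psi1_norm P X) => [K| |]// _ _.
have [C0 h] : 0 < K + 1 /\ (moment X (K + 1) <= 2%:E)%E.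
  by apply: (psi1_moment mX (K := K)); rewrite ?E// ltrDl.
exact: psi1_integrable C0 h.
Qed.

(** [moment_shift] asks for an actual moment bound, which is available at [K + e] for every e > 0.
    The term |E Y| / ln 2 of the first bound originates here. *)
Lemma psi1_norm_centered X K : measurable_fun setT X ->
  (psi1_norm P X <= K%:E)%E ->
  (psi1_norm P (centered P X) <= (K + `|mean P X / ln 2|)%:E)%E.
Proof.
move=> mX XK; apply/lee_addgt0Pr => e e0.
have [C0 h] := psi1_moment mX XK (ltac:(by rewrite ltrDl) : K < K + e).
rewrite -EFinD addrAC; apply: psi1_le; first by rewrite ltr_pwDl.
exact: moment_shift.
Qed.

End psi1.

(** * Products of independent random variables *)

Section independence.
Import HBNNSimple.
Context {d : measure_display} {T : measurableType d} {R : realType}.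
Variable P : probability T R.

Lemma measurable_indic_comp (X : T -> R) (B : set R) :
  measurable_fun setT X -> measurable B ->
  measurable_fun setT (fun x => \1_B (X x) : R).
Proof. by move=> mX mB; apply: measurableT_comp. Qed.

(** Extension from indicators to nonnegative measurable functions of [X], by simple functions and
    monotone convergence. In the use below, [G] is a product of factors and [H] the constant product
    of their means. *)
Lemma integral_comp_mul_ext (X G H : T -> R) (f : R -> R) :
  measurable_fun setT X -> measurable_fun setT G -> measurable_fun setT H ->
  (forall x, 0 <= G x) -> (forall x, 0 <= H x) ->
  (forall B, measurable B -> (\int[P]_x (\1_B (X x) * G x)%:E =
                              \int[P]_x (\1_B (X x) * H x)%:E)%E) ->
  measurable_fun setT f -> (forall r, 0 <= f r) ->
  (\int[P]_x (f (X x) * G x)%:E = \int[P]_x (f (X x) * H x)%:E)%E.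
Proof.
move=> mX mG mH G0 H0 GH mf f0.
have mEf : measurable_fun setT (EFin \o f) by exact/measurable_EFinP.
pose h := nnsfun_approx measurableT mEf.
pose A n r := h n @^-1` [set r].
have mA n r : measurable (A n r) by exact: measurable_funPTI.
(* The right-hand side sees [g] only through integrals against indicators of [X], where [G] and [H]
   agree. *)
suff approx (g : T -> R) : measurable_fun setT g -> (forall x, 0 <= g x) ->
    (\int[P]_x (f (X x) * g x)%:E = limn (fun n =>
      \sum_(r \in range (h n)) r%:E * \int[P]_x (\1_(A n r) (X x) * g x)%:E))%E.
  rewrite !approx//; congr (limn _); apply/funext => n.
  by apply: eq_fsbigr => r _; rewrite GH.
move=> mg g0.
have mhX n : measurable_fun setT (fun x => h n (X x)).
  exact: measurableT_comp.
transitivity (limn (fun n => \int[P]_x (h n (X x) * g x)%:E)%E).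
  rewrite -monotone_convergence//.
  - apply: eq_integral => x _; apply/esym/cvg_lim => //.
    apply: cvg_EFin; first by near=> n.
    rewrite /=; apply: cvgMr_tmp.
    have := @cvg_nnsfun_approx _ _ _ _ measurableT _ mEf (fun x _ => f0 x) (X x) Logic.I.
    by move/fine_cvgP => [].
  - by move=> n; apply/measurable_EFinP; exact: measurable_funM.
  - by move=> n x _; rewrite lee_fin mulr_ge0.
  - move=> x _ m n mn; rewrite lee_fin ler_wpM2r//.
    exact/lefP/nd_nnsfun_approx.
congr (limn _); apply/funext => n.
transitivity (\int[P]_x (\sum_(r \in range (h n)) r%:E * (\1_(A n r) (X x) * g x)%:E))%E.
  apply: eq_integral => x _.
  rewrite fimfunE EFinM -fsumEFin// ge0_mule_fsuml//.
    by apply: eq_fsbigr => r _; rewrite !EFinM muleA.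
  by move=> r; exact: nnfun_muleindic_ge0.
rewrite ge0_integral_fsum//.
- apply: eq_fsbigr => r /[!inE] -[y _ <-].
  rewrite ge0_integralZl//.
  + apply/measurable_EFinP; apply: measurable_funM => //.
    exact: measurable_indic_comp.
  + by move=> x _; rewrite lee_fin mulr_ge0.
  + by rewrite lee_fin.
- move=> r; apply: measurable_funeM; apply/measurable_EFinP.
  by apply: measurable_funM => //; exact: measurable_indic_comp.
- move=> r x _; rewrite -EFinM lee_fin mulrA mulr_ge0// -lee_fin.
  exact: nnfun_muleindic_ge0.
Unshelve. all: by end_near.
Qed.

Lemma integral_indicT (A : set T) : measurable A ->
  (\int[P]_x (\1_A x)%:E = P A)%E.
Proof. by move=> mA; rewrite integral_indic// setIT. Qed.

Lemma integral_prod_independent (I : finType) (Y : I -> {RV P >-> R})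
    (f : I -> R -> R) (m : I -> R) : mutually_independent Y ->
  (forall i, measurable_fun setT (f i)) -> (forall i r, 0 <= f i r) ->
  (forall i, (\int[P]_x (f i (Y i x))%:E = (m i)%:E)%E) ->
  (\int[P]_x (\prod_i f i (Y i x))%:E = (\prod_i m i)%:E)%E.
Proof.
move=> indep.
(* The functions f i are arbitrary for i in s and indicators elsewhere, so that
   the definition of independence is the case where s is empty. *)
suff H (s : seq I) : forall (f : I -> R -> R) (m : I -> R),
    (forall i, i \notin s -> exists2 B, measurable B & f i = \1_B) ->
    (forall i, measurable_fun setT (f i)) -> (forall i r, 0 <= f i r) ->
    (forall i, (\int[P]_x (f i (Y i x))%:E = (m i)%:E)%E) ->
    (\int[P]_x (\prod_i f i (Y i x))%:E = (\prod_i m i)%:E)%E.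
  by apply: (H (enum I)) => i; rewrite mem_enum.
elim: s => [|j s IH] {}f {}m fs mf f0 fm.
  (* All factors are indicators: their product is the indicator of an intersection, and independence
     applies with the full index set. *)
  have /choice[B BP] : forall i, exists B, measurable B /\ f i = \1_B.
    by move=> i; have [//|B] := fs i; exists B.
  have mB i : measurable (B i) by have [] := BP i.
  have fB i : f i = \1_(B i) by have [] := BP i.
  have mPE i : (m i)%:E = P (Y i @^-1` B i).
    rewrite -fm fB -integral_indicT//.
    exact: measurable_funPTI.
  transitivity (P (\bigcap_(i in [set` [set: I]%SET]) (Y i @^-1` B i))).
    rewrite -integral_indicT; last first.
      apply: fin_bigcap_measurable => // i _.
      exact: measurable_funPTI.
    apply: eq_integral => x _; congr EFin.
    rewrite indicE; case: (pselect (forall i, B i (Y i x))) => [h|].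
      rewrite mem_set; last by move=> i _; exact: h.
      by rewrite big1// => i _; rewrite fB indicE mem_set.
    move/existsNP => [i nBi]; rewrite memNset; last first.
      by move=> /(_ i) h; apply: nBi; apply: h; rewrite /= inE.
    by rewrite (bigD1 i)//= fB indicE memNset// mul0r.
  rewrite indep// -prodEFin; apply: eq_big => [i|i _]; first by rewrite inE.
  by rewrite mPE.
pose G x := \prod_(i | i != j) f i (Y i x).
pose c := \prod_(i | i != j) m i.
have mfY i : measurable_fun setT (fun x => f i (Y i x)).
  exact: measurableT_comp.
have mG : measurable_fun setT G.
  by rewrite /G; under eq_fun do rewrite -big_filter; exact: measurable_prod.
have G0 x : 0 <= G x by apply: prodr_ge0.
have m0 i : 0 <= m i.
  by rewrite -lee_fin -fm; apply: integral_ge0 => x _; rewrite lee_fin.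
have c0 : 0 <= c by apply: prodr_ge0.
have splt (x : T) : \prod_i f i (Y i x) = f j (Y j x) * G x by rewrite (bigD1 j).
under eq_integral do rewrite splt.
(* Replacing the other factors by their constant [c] has to be justified only against indicators of
   [Y j]. *)
rewrite (@integral_comp_mul_ext _ _ (cst c))//.
- under eq_integral do rewrite /= EFinM muleC.
  rewrite ge0_integralZl ?fm//; last first.
  + by move=> x _; rewrite lee_fin.
  + exact/measurable_EFinP.
  by rewrite -EFinM mulrC (bigD1 j).
- move=> B mB.
  (* With an indicator at [j], the functions outside [s] are all indicators, so the induction
     hypothesis applies. *)
  pose f' i := if i == j then \1_B : R -> R else f i.
  have mf' i : measurable_fun setT (f' i).
    by rewrite /f'; case: ifP.
  have PB : measurable (Y j @^-1` B).
    exact: measurable_funPTI.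
  pose m' i := if i == j then fine (P (Y j @^-1` B)) else m i.
  have fm' i : (\int[P]_x (f' i (Y i x))%:E = (m' i)%:E)%E.
    rewrite /f' /m'; case: eqP => [->|_]; last exact: fm.
    rewrite fineK ?fin_num_measure// -integral_indicT//.
  have /= := IH f' m' _ mf' _ fm'.
  have -> : (fun x => (\prod_i f' i (Y i x))%:E) = (fun x => (\1_B (Y j x) * G x)%:E).
    apply/funext => x; rewrite (bigD1 j)//= {1}/f' eqxx; congr (_ * _)%:E.
    by apply: eq_bigr => i /negPf ij; rewrite /f' ij.
  move=> ->.
  + under [RHS]eq_integral do rewrite /= EFinM muleC.
    rewrite ge0_integralZl//=.
    * rewrite (bigD1 j)//= mulrC EFinM /m' eqxx fineK ?fin_num_measure//; congr (_ * _)%E.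
        by congr EFin; apply: eq_bigr => i /negPf ->.
      by rewrite -integral_indicT.
    * by apply/measurable_EFinP; exact: measurable_indic_comp.
  + move=> i; rewrite /f'; case: eqP => [_ _|ij iNs]; first by exists B.
    by apply: fs; rewrite inE negb_or iNs andbT; exact/eqP.
  + by move=> i r; rewrite /f'; case: eqP.
Qed.

End independence.

(** * Tail bounds for weighted sums *)

Section weights.
Context {R : realType} {n : nat}.
Implicit Types w K : 'I_n -> R.

Lemma max_weighted_ge0 w K : 0 <= max_weighted w K.
Proof. exact: bigmax_ge_id. Qed.

Lemma le_max_weighted w K i : `|w i| * K i <= max_weighted w K.
Proof. exact: le_bigmax. Qed.

Lemma sum_weighted_sq_ge0 w K : 0 <= sum_weighted_sq w K.
Proof. by apply: sumr_ge0 => i _; rewrite mulr_ge0 ?sqr_ge0. Qed.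

(** In this degenerate case the constraint [s * max_weighted w K < 1] holds for every [s]. *)
Lemma max_weighted_eq0 w K :
  sum_weighted_sq w K = 0 -> max_weighted w K = 0.
Proof.
move=> /eqP; rewrite psumr_eq0 => [/allP wK|i _]; last by rewrite mulr_ge0 ?sqr_ge0.
apply/eqP; rewrite eq_le max_weighted_ge0 andbT; apply: bigmax_le => // i _.
have := wK i (mem_index_enum i); rewrite /= mulf_eq0 !sqrf_eq0.
by case/orP => /eqP ->; rewrite ?normr0 ?mul0r ?mulr0.
Qed.

Lemma max_weighted_gt0 w K : (forall i, 0 <= K i) ->
  0 < sum_weighted_sq w K -> 0 < max_weighted w K.
Proof.
move=> K0 V0; rewrite lt_neqAle max_weighted_ge0 andbT eq_sym.
apply: contraTneq V0 => M0; rewrite -leNgt.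
apply: sumr_le0 => i _.
have := le_max_weighted w K i; rewrite M0 => wK.
have : `|w i| * K i = 0 by apply/eqP; rewrite eq_le wK mulr_ge0.
move=> /(congr1 (fun x => x ^+ 2)); rewrite exprMn real_normK ?num_real// => ->.
by rewrite expr0n.
Qed.

End weights.

(** * Choice of the Chernoff parameter *)

Section optimization.
Context {R : realFieldType}.

Lemma bernstein_exponent (V M t : R) : 0 < V -> 0 < M -> 0 < t ->
  exists s, [/\ 0 < s, s * M < 1 &
    s ^+ 2 * V - s * t <= - (4^-1 * Num.min (t ^+ 2 / (2 * V)) (t / M))].
Proof.
move=> V0 M0 t0; set y := t * M; have y0 : 0 < y by rewrite mulr_gt0.
have D0 : 0 < V + y by rewrite addr_gt0.
(* The unconstrained minimiser is t / (2 V); adding [y] to the denominator forces s M < 1/2. *)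
exists (t / (2 * (V + y))); split.
- by rewrite divr_gt0// mulr_gt0.
- by rewrite mulrAC ltr_pdivrMr ?mulr_gt0// mul1r -/y; lra.
have -> : (t / (2 * (V + y))) ^+ 2 * V - t / (2 * (V + y)) * t =
    - (4^-1 * (t ^+ 2 * ((V + 2 * y) / (V + y) ^+ 2))).
  by field; rewrite gt_eqF.
rewrite lerN2 ler_pM2l// ge_min.
have D2 : 0 < (V + y) ^+ 2 by rewrite exprn_gt0.
(* The two terms of the minimum coincide exactly at [y = 2 * V]. *)
have [y2|y2] := leP y (2 * V); apply/orP; [left|right].
  rewrite ler_pM2l ?exprn_gt0// ler_pdivlMr// ler_pdivrMl ?mulr_gt0//.
  nra.
have -> : t / M = t ^+ 2 * y^-1 by rewrite /y; field; rewrite !gt_eqF.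
rewrite ler_pM2l ?exprn_gt0// ler_pdivlMr// ler_pdivrMl//.
nra.
Qed.

(** Here [a], [b], [c] stand for the square roots of V, t and 2, which makes the claim rational. The
    slack is a square times a sum of terms that are nonnegative when [1 <= c]. *)
Lemma bernstein_tail_exponent (a b M : R) (c : R) : 0 < a -> 0 < b -> 0 <= M ->
  1 <= c -> exists s, [/\ 0 < s, s * M < 1 &
    s ^+ 2 * a ^+ 2 - s * (2 * (c * b * a) + 2 * b ^+ 2 * M) <= - b ^+ 2].
Proof.
move=> a0 b0 M0 c1.
have D0 : 0 < a + b * M by rewrite ltr_pwDl// mulr_ge0// ltW.
exists (b / (a + b * M)); split.
- by rewrite divr_gt0.
- by rewrite mulrAC ltr_pdivrMr// mul1r ltrDr.
rewrite -subr_ge0.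
have -> : - b ^+ 2 - ((b / (a + b * M)) ^+ 2 * a ^+ 2 -
    b / (a + b * M) * (2 * (c * b * a) + 2 * b ^+ 2 * M)) =
   (b / (a + b * M)) ^+ 2 *
     (2 * a ^+ 2 * (c - 1) + 2 * c * a * (b * M) + (b * M) ^+ 2).
  by field; rewrite gt_eqF.
have bM : 0 <= b * M by rewrite mulr_ge0// ltW.
rewrite mulr_ge0 ?sqr_ge0// !addr_ge0 ?sqr_ge0//.
  by apply: mulr_ge0; [rewrite mulr_ge0 ?sqr_ge0|rewrite subr_ge0].
by apply: mulr_ge0 => //; rewrite !mulr_ge0// ?ltW// (lt_le_trans ltr01).
Qed.

End optimization.

(** * Chernoff bounds under a psi_1 control of the centered variables *)

Section bernstein.
Context {d : measure_display} {T : measurableType d} {R : realType}.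
Variables (P : probability T R) (n : nat) (Y : 'I_n -> {RV P >-> R}).
Variable K : 'I_n -> R.
Implicit Types w : 'I_n -> R.
Hypothesis indepY : mutually_independent Y.
Hypothesis K0 : forall i, 0 <= K i.
Hypothesis intY : forall i, P.-integrable setT (EFin \o Y i).
Hypothesis YK : forall i, (psi1_norm P (centered P (Y i)) <= (K i)%:E)%E.

(* The infimum defining the psi_1 norm need not be known to be attained: the
   bound is passed to the limit from the constants C > K i. *)
Lemma psi1_mgf i (s : R) : `|s| * K i < 1 ->
  (\int[P]_x (expR (s * centered P (Y i) x))%:E <= (expR (s ^+ 2 * K i ^+ 2))%:E)%E.
Proof.
move=> sK.
have mC := measurable_centered P (measurable_funPT (Y i)).
have H C : K i < C -> `|s| * C <= 1 ->
    (\int[P]_x (expR (s * centered P (Y i) x))%:E <= (expR (s ^+ 2 * C ^+ 2))%:E)%E.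
  move=> KC sC; have [C0 hC] := psi1_moment mC (YK i) KC.
  by apply: mgf_le_expR_sqr => //; exact: integral_centered.
have cv : (expR (s ^+ 2 * C ^+ 2))%:E @[C --> (K i)^'+] --> (expR (s ^+ 2 * K i ^+ 2))%:E.
  apply: cvg_EFin; first by near=> C.
  rewrite /=; apply: cvg_at_right_filter.
  apply: (cvg_comp _ expR); last exact: continuous_expR.
  by apply: cvgM; [exact: cvg_cst|exact: exprn_continuous].
(* The strict inequality |s| K < 1 leaves room for constants C > K with |s| C <= 1. *)
have cs : `|s| * C @[C --> (K i)^'+] --> `|s| * K i.
  by apply: cvg_at_right_filter; apply: cvgMl_tmp; exact: cvg_id.
apply: (cvge_to_ge cv); near=> C; apply: H => //.
by apply/ltW; near: C; exact: (cvgr_lt _ cs).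
Unshelve. all: by end_near.
Qed.

Lemma measurable_weighted_centered_sum w :
  measurable_fun setT (weighted_centered_sum w Y).
Proof.
apply: measurable_sum => i; apply: measurable_funM => //.
exact: measurable_centered.
Qed.

Lemma weighted_sum_chernoff w (s x : R) : 0 < s -> s * max_weighted w K < 1 ->
  (P [set z | x <= weighted_centered_sum w Y z]%R <=
    (expR (s ^+ 2 * sum_weighted_sq w K - s * x))%:E)%E.
Proof.
move=> s0 sM.
(* Each factor is a moment generating function at [s * w i], which must lie in the range of
   [psi1_mgf]. *)
have swK i : `|s * w i| * K i < 1.
  apply: le_lt_trans sM; rewrite normrM (gtr0_norm s0) -mulrA ler_pM2l//.
  exact: le_max_weighted.
pose S : {RV P >-> R} := mfun_Sub (mem_set (measurable_weighted_centered_sum w)).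
have := chernoff S x s0; rewrite /mmt_gen_fun unlock => /le_trans; apply.
rewrite expRD EFinM lee_pmul2r//; last first.
  by rewrite lte_fin expR_gt0.
pose f i y := expR (s * w i * (y - mean P (Y i))).
have If i : (\int[P]_x (f i (Y i x))%:E <= (expR (s ^+ 2 * (w i ^+ 2 * K i ^+ 2)))%:E)%E.
  by rewrite mulrA -exprMn; exact: psi1_mgf.
have fe0 i y : 0 <= f i y by exact: expR_ge0.
have If0 i : (0 <= \int[P]_x (f i (Y i x))%:E)%E.
  by apply: integral_ge0 => y _; rewrite lee_fin.
have Ifin i : (\int[P]_x (f i (Y i x))%:E)%E \is a fin_num.
  by rewrite ge0_fin_numE// (le_lt_trans (If i))// ltry.
have -> : (\int[P]_x ((expR \o s \o* S) x)%:E = \int[P]_x (\prod_i f i (Y i x))%:E)%E.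
  apply: eq_integral => y _; congr EFin.
  by rewrite /= mulrC /weighted_centered_sum mulr_sumr expR_sum; apply: eq_bigr => i _; rewrite mulrA.
rewrite (integral_prod_independent (f := f)
  (m := fun i => fine (\int[P]_x (f i (Y i x))%:E)%E) indepY)//.
- rewrite lee_fin mulr_sumr expR_sum; apply: ler_prod => i _.
  by rewrite fine_ge0//= -lee_fin fineK.
- move=> i; apply: measurableT_comp => //; apply: measurable_funM => //.
  exact: measurable_funB.
- by move=> i; rewrite fineK.
Qed.

(** The one-sided bound is used for [w] and [- w], which share V and M; the union bound gives the
    factor 2. *)
Lemma weighted_sum_two_sided w (s x : R) :
  0 < s -> s * max_weighted w K < 1 ->
  (P [set z | x <= `|weighted_centered_sum w Y z| ]%R <=
    (2 * expR (s ^+ 2 * sum_weighted_sq w K - s * x))%:E)%E.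
Proof.
move=> s0 sM.
pose w' i := - w i.
have sM' : s * max_weighted w' K < 1.
  by rewrite /max_weighted; under eq_bigr do rewrite normrN.
have h1 := weighted_sum_chernoff x s0 sM.
have := weighted_sum_chernoff x s0 sM'.
have -> : sum_weighted_sq w' K = sum_weighted_sq w K.
  by apply: eq_bigr => i _; rewrite sqrrN.
have -> : weighted_centered_sum w' Y = (fun z => - weighted_centered_sum w Y z).
  apply/funext => z; rewrite /weighted_centered_sum -sumrN.
  by apply: eq_bigr => i _; rewrite mulNr.
move=> h2.
have mS := measurable_weighted_centered_sum w.
have -> : [set z | x <= `|weighted_centered_sum w Y z| ] =
    [set z | x <= weighted_centered_sum w Y z] `|`
    [set z | x <= - weighted_centered_sum w Y z].
  by apply/seteqP; split=> z /=; rewrite ler_normr => /orP.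
rewrite mulr_natl mulr2n EFinD (le_trans _ (leeD h1 h2))//.
apply: measureU2.
- by rewrite -[X in measurable X]setTI; apply: measurable_fun_ler.
- by rewrite -[X in measurable X]setTI; apply: measurable_fun_ler => //; exact: measurableT_comp.
Qed.

Lemma weighted_sum_degenerate w (x : R) :
  sum_weighted_sq w K = 0 -> 0 < x ->
  (P [set z | x <= `|weighted_centered_sum w Y z| ]%R = 0)%E.
Proof.
move=> V0 x0; apply/eqP; rewrite eq_le measure_ge0 andbT.
apply/lee_addgt0Pr => e e0; rewrite add0e.
(* With V = M = 0 any s > 0 is allowed. This one gives s x = 2 / e, and 2 exp(- 2 / e) <= e because
   exp(2 / e) >= 2 / e. *)
have s0 : 0 < 2 / e / x by rewrite !divr_gt0.
have := @weighted_sum_two_sided w _ x s0.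
rewrite V0 max_weighted_eq0// mulr0 => /(_ ltr01) /le_trans; apply.
rewrite lee_fin mulr0 add0r divfK ?gt_eqF// expRN ler_pdivrMr ?expR_gt0//.
rewrite mulrC -ler_pdivrMr// (le_trans _ (expR_ge1Dx _))//.
by rewrite lerDr.
Qed.

Lemma weighted_sum_bernstein w (t : R) : 0 <= t ->
  (P [set z | t <= `|weighted_centered_sum w Y z| ]%R <=
    bernstein_bound w K t)%E.
Proof.
rewrite le_eqVlt => /predU1P[<-|t0].
  (* At t = 0 both numerators vanish, so the quotients are 0 whatever the denominators, and the
     bound is 2. *)
  rewrite /bernstein_bound expr0n/= !mul0e minxx mule0 oppe0 expeR0 mule1.
  rewrite (_ : [set _ | _] = setT); last by apply/seteqP; split=> z //=.
  by rewrite probability_setT lee_fin ler1n.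
have := sum_weighted_sq_ge0 w K; rewrite le_eqVlt => /predU1P[V0|V0].
  rewrite weighted_sum_degenerate// /bernstein_bound.
  by rewrite mule_ge0// expeR_ge0.
have M0 := max_weighted_gt0 K0 V0.
have [s [s0 sM H]] := bernstein_exponent V0 M0 t0.
apply: le_trans (weighted_sum_two_sided t s0 sM) _.
rewrite /bernstein_bound !inver !gt_eqF ?mulr_gt0//.
rewrite -!EFinM -EFin_min -EFinM lee_fin.
by rewrite ler_pM2l// ler_expR.
Qed.

Lemma weighted_sum_tail w (t : R) : 0 <= t ->
  (P [set z | 2 * Num.sqrt (2 * t * sum_weighted_sq w K)
                + 2 * t * max_weighted w K
              < `|weighted_centered_sum w Y z| ]%R <=
     (2 * expR (- t))%:E)%E.
Proof.
set A := [set z | _].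
have mS : measurable_fun setT (fun z => `|weighted_centered_sum w Y z|).
  by apply: measurableT_comp => //; exact: measurable_weighted_centered_sum.
have mA : measurable A.
  by rewrite -[X in measurable X]setTI; apply: measurable_fun_ltr.
rewrite le_eqVlt => /predU1P[t0|t0].
  by rewrite (le_trans (probability_le1 _ mA))// lee_fin -t0 oppr0 expR0 mulr1 ler1n.
have := sum_weighted_sq_ge0 w K; rewrite le_eqVlt => /predU1P[V0|V0].
  (* The threshold is now 0, so the event is that the sum is nonzero: a countable union of null
     events |S| >= 1 / (k + 1). *)
  suff -> : P A = 0%E by rewrite lee_fin mulr_ge0 ?expR_ge0.
  apply: measure_negligible; first exact: mA.
  apply: (negligibleS (A :=
    \bigcup_k [set z | k.+1%:R^-1 <= `|weighted_centered_sum w Y z|])).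
    move=> z; rewrite /A/= -V0 mulr0 sqrtr0 max_weighted_eq0// !mulr0 addr0 => Sz.
    exists (Num.truncn `|weighted_centered_sum w Y z|^-1) => //=.
    rewrite invf_ple ?posrE// ltW//.
    by rewrite truncnS_gt.
  apply: negligible_bigcup => k; apply/negligibleP.
    rewrite -[X in measurable X]setTI; exact: measurable_fun_ler.
  by apply: weighted_sum_degenerate => //; rewrite invr_gt0.
(* Writing sqrt (2 t V) as a product of three square roots puts the threshold in the form 2 c b a +
   2 b^2 M. *)
pose a := Num.sqrt (sum_weighted_sq w K).
have [s [s0 sM H]] := @bernstein_tail_exponent _ a (Num.sqrt t)
   (max_weighted w K) (Num.sqrt 2) (ltac:(by rewrite sqrtr_gt0))
   (ltac:(by rewrite sqrtr_gt0)) (max_weighted_ge0 w K) (ltac:(by rewrite -{1}sqrtr1 ler_sqrt// ler1n)).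
apply: (@le_trans _ _ (P [set z | 2 * Num.sqrt (2 * t * sum_weighted_sq w K)
                + 2 * t * max_weighted w K
              <= `|weighted_centered_sum w Y z| ]%R)).
  apply: le_measure; rewrite ?inE//.
    by rewrite -[X in measurable X]setTI; apply: measurable_fun_ler.
  by move=> z /ltW.
apply: le_trans (weighted_sum_two_sided _ s0 sM) _.
rewrite lee_fin ler_pM2l// ler_expR.
move: H; rewrite /a !sqr_sqrtr ?(ltW t0) ?(ltW V0)//.
by rewrite (sqrtrM (sum_weighted_sq w K)) ?mulr_ge0 ?(ltW t0)// sqrtrM.
Qed.

End bernstein.

(** * The Gamma integral *)

Section gamma.
Context {R : realType}.
Local Notation mu := (@lebesgue_measure R).
Local Notation gamma_integral k :=
  (\int[mu]_(s in `]0%R, +oo[) ((s : R) `^ (k - 1) * expR (- s))%:E)%E.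

(** By uniqueness of Lebesgue measure: [c] times the pushforward gives each half-open interval its
    length. *)
Lemma lebesgue_measure_scale (c : R) (c0 : 0 < c) (A : set R) : measurable A ->
  pushforward mu (fun x : measurableTypeR R => (c * x : measurableTypeR R)) A = (c^-1%:E * mu A)%E.
Proof.
move=> mA.
have cV0 : 0 <= c by exact: ltW.
set f := fun x : measurableTypeR R => (c * x : measurableTypeR R).
have mf : measurable_fun setT f by exact: mulrl_measurable.
have /(_ mf) H := @lebesgue_measure_unique R (mscale (NngNum cV0) (pushforward mu f)).
rewrite H//.
  rewrite /mscale /= muleA -EFinM mulVf ?gt_eqF// mul1e//.
move=> _ [[a b]] _ <-.
have fab : f @^-1` `]a, b]%classic = `]a / c, b / c]%classic.
  apply/seteqP; split=> x; rewrite /f /= !in_itv/= ltr_pdivrMr// ler_pdivlMr//.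
    by rewrite mulrC.
  by rewrite mulrC.
transitivity (c%:E * mu (f @^-1` `]a, b]%classic))%E; last by [].
rewrite fab.
have muE (u v : R) : mu `]u, v]%classic = (Num.max 0 (v - u))%:E.
  rewrite lebesgue_measure_itv/= lte_fin; case: ltP => uv.
    by rewrite max_r ?subr_ge0 ?ltW// EFinB.
  by rewrite max_l// subr_le0.
rewrite !muE -EFinM maxr_pMr// mulr0.
by congr (Num.max _ _)%:E => /=; field; rewrite gt_eqF.
Qed.

Lemma ge0_integral_scale (c : R) (f : R -> \bar R) : 0 < c ->
  measurable_fun setT f -> (forall x, 0 <= f x)%E ->
  (\int[mu]_(x in `]0%R, +oo[) f (c * x)%R = c^-1%:E * \int[mu]_(x in `]0%R, +oo[) f x)%E.
Proof.
move=> c0 mf f0.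
have cV0 : 0 <= c^-1 by rewrite invr_ge0 ltW.
pose h : measurableTypeR R -> measurableTypeR R := fun x => c * x.
have hI : h @^-1` `]0, +oo[%classic = `]0, +oo[%classic.
  by apply/seteqP; split=> x; rewrite /h /= !in_itv/= !andbT pmulr_rgt0.
have := @ge0_integral_pushforward _ _ _ _ R h _ mu `]0, +oo[%classic f.
rewrite hI => <-//; last 2 first.
- exact: mulrl_measurable.
- exact: measurable_funTS.
rewrite -[RHS](@ge0_integral_mscale _ _ R mu `]0, +oo[%classic _ (NngNum cV0) f)//.
  apply: eq_measure_integral => [|mh A mA _]; first exact: mulrl_measurable.
  exact: (lebesgue_measure_scale c0 mA).
exact: measurable_funTS.
Qed.

Lemma measurable_gamma_integrand (k : R) (D : set R) :
  measurable_fun D (fun s => (s `^ (k - 1) * expR (- s))%:E).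
Proof.
apply/measurable_EFinP; apply: measurable_funM.
  exact: measurable_funTS (measurable_powR _).
by apply: measurableT_comp => //; exact: oppr_measurable.
Qed.

(** The integrand may blow up at 0, so the fundamental theorem of calculus is applied on compact
    intervals exhausting the domain. *)
Lemma integral_powR_itv01 (k : R) : 0 < k ->
  (\int[mu]_(s in `]0%R, 1%R]) ((s : R) `^ (k - 1))%:E <= k^-1%:E)%E.
Proof.
move=> k0.
(* The shift by 2 keeps the left endpoint strictly below 1. *)
pose F (i : nat) : set R := `[i.+2%:R^-1, 1]%classic.
have -> : `]0, 1]%classic = \bigcup_i F i.
  apply/seteqP; split=> x /=; rewrite /F.
    rewrite in_itv/= => /andP[x0 x1].
    exists (Num.truncn x^-1) => //=; rewrite in_itv/= x1 andbT.
    rewrite invf_ple ?posrE// (le_trans (ltW (truncnS_gt _)))//.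
    by rewrite ler_nat.
  move=> [i _] /=; rewrite !in_itv/= => /andP[x0 ->]; rewrite andbT.
  by rewrite (lt_le_trans _ x0).
have mpow (D : set R) : measurable_fun D (fun s : R => (s `^ (k - 1))%:E).
  by apply/measurable_EFinP; exact: measurable_funTS (measurable_powR _).
have cv : (\int[mu]_(s in F i) ((s : R) `^ (k - 1))%:E)%E @[i --> \oo] -->
    (\int[mu]_(s in \bigcup_i F i) ((s : R) `^ (k - 1))%:E)%E.
  apply: ge0_nondecreasing_set_cvg_integral => //.
  - apply/nondecreasing_seqP => i; apply/subsetPset => x.
    rewrite /F /= !in_itv/= => /andP[h ->]; rewrite andbT (le_trans _ h)//.
    by rewrite lef_pV2 ?posrE// ler_nat.
  - by move=> i; exact: measurable_itv.
  - by move=> i; exact: mpow.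
  - by move=> i x _; rewrite lee_fin powR_ge0.
apply: (cvge_to_le cv).
near=> i.
have i0 : 0 < i.+2%:R^-1 :> R by rewrite invr_gt0.
have pos (x : R) : x \in `[i.+2%:R^-1, 1] -> 0 < x.
  by rewrite in_itv/= => /andP[h _]; rewrite (lt_le_trans i0).
have derF (x : R) : 0 < x -> is_derive x 1 (fun x => k^-1 * x `^ k) (x `^ (k - 1)).
  move=> x0; have kx := is_derive1_powR k x0.
  have := is_deriveZ k^-1 kx.
  by rewrite [k^-1 *: _]mulrA mulVf ?gt_eqF// mul1r.
rewrite (@continuous_FTC2 _ _ (fun x => k^-1 * x `^ k))//.
- rewrite powR1 mulr1 -EFinB lee_fin gerBl mulr_ge0 ?powR_ge0// invr_ge0 ltW//.
- by rewrite invf_lt1// ltr1n.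
- apply: derivable_within_continuous => x /pos x0.
  by apply: derivable_powR; rewrite in_itv/= x0.
- have cF (x : R) : 0 < x -> {for x, continuous (fun x : R => k^-1 * x `^ k)}.
    move=> x0; apply: differentiable_continuous; apply/derivable1_diffP.
    by have [] := derF x x0.
  split.
  + by move=> x /subset_itv_oo_cc /pos x0; have [] := derF x x0.
  + by apply: cvg_at_right_filter; exact: cF.
  + by apply: cvg_at_left_filter; exact: cF.
- move=> x /subset_itv_oo_cc /pos x0; rewrite derive1E.
  by have [_ ->] := derF x x0.
Unshelve. all: by end_near.
Qed.

(** From ln x <= x - 1 at x = s / (2 k). The scale 2 k yields the slope 1/2, so the product with
    exp(- s) still decays. *)
Lemma powR_le_expR (k s : R) : 0 < k -> 1 <= s ->
  s `^ (k - 1) <= expR (k * (ln (2 * k) - 1)) * expR (s / 2).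
Proof.
move=> k0 s1; have s0 : 0 < s by rewrite (lt_le_trans ltr01).
rewrite (@le_trans _ _ (s `^ k))//; first by rewrite ler_powR// gerBl.
rewrite /powR gt_eqF// -expRD ler_expR.
have c0 : 0 < 2 * k by rewrite mulr_gt0.
have := expR_ge1Dx (ln (s / (2 * k))).
rewrite lnK ?posrE ?divr_gt0// ln_div ?posrE// => h.
have : k * ln s <= k * (s / (2 * k) - 1 + ln (2 * k)).
  by rewrite ler_pM2l//; lra.
move=> /le_trans; apply; rewrite le_eqVlt; apply/orP; left; apply/eqP.
by field; rewrite gt_eqF.
Qed.

(** Near 0 the exponential is bounded by 1; beyond 1 the integrand is dominated by a multiple of the
    exponential density of rate 1/2. *)
Lemma gamma_integral_lty (k : R) : 0 < k -> (gamma_integral k < +oo)%E.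
Proof.
move=> k0.
have g0 (s : R) : (0 <= (s `^ (k - 1) * expR (- s))%:E)%E.
  by rewrite lee_fin mulr_ge0 ?powR_ge0 ?expR_ge0.
have mg (D : set R) : measurable_fun D (fun s : R => (s `^ (k - 1) * expR (- s))%:E).
  exact: measurable_gamma_integrand.
have -> : `]0, +oo[%classic = `]0, 1]%classic `|` `]1, +oo[%classic :> set R.
  by rewrite -itv_bndbnd_setU// bnd_simp.
rewrite ge0_integral_setU//=; last 2 first.
- exact: mg.
- apply/disj_setPS => x [] /=; rewrite !in_itv/= andbT => /andP[_ x1].
  by rewrite ltNge x1.
rewrite lte_add_pinfty//.
  apply: (@le_lt_trans _ _ k^-1%:E); last exact: ltry.
  apply: le_trans (integral_powR_itv01 k0).
  apply: ge0_le_integral => //.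
    exact: mg.
    by apply/measurable_EFinP; exact: measurable_funTS (measurable_powR _).
  move=> s /=; rewrite in_itv/= => /andP[s0 _]; rewrite lee_fin ler_piMr ?powR_ge0//.
  by rewrite expR_le1 oppr_le0 ltW.
pose C := 2 * expR (k * (ln (2 * k) - 1)).
apply: (@le_lt_trans _ _ (\int[mu]_(s in `]1%R, +oo[) (C%:E * (exponential_pdf 2^-1 s)%:E))%E).
  apply: ge0_le_integral => //.
    exact: mg.
    apply: measurable_funeM; apply/measurable_EFinP.
    by apply: measurable_funTS; exact: measurable_exponential_pdf.
  move=> s /=; rewrite in_itv/= andbT => s1.
  have s0 : 0 < s by rewrite (lt_trans ltr01).
  rewrite exponential_pdfE ?(ltW s0)// lee_fin.
  have -> : C * (2^-1 * expR (- 2^-1 * s)) =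
    expR (k * (ln (2 * k) - 1)) * expR (s / 2) * expR (- s).
    rewrite -mulrA -expRD (_ : s / 2 - s = - 2^-1 * s); last by field.
    by rewrite /C; field.
  by rewrite ler_wpM2r ?expR_ge0//; apply: powR_le_expR => //; exact: ltW.
rewrite ge0_integralZl//; last 3 first.
- apply/measurable_EFinP.
  by apply: measurable_funTS; exact: measurable_exponential_pdf.
- by move=> s _; rewrite lee_fin exponential_pdf_ge0.
- by rewrite lee_fin mulr_ge0 ?expR_ge0.
rewrite lte_mul_pinfty//; first by rewrite lee_fin mulr_ge0 ?expR_ge0.
apply: (@le_lt_trans _ _ (\int[mu]_s (exponential_pdf 2^-1 s)%:E)%E).
  apply: ge0_subset_integral => //.
  - apply/measurable_EFinP; exact: measurable_exponential_pdf.
  - by move=> s _; rewrite lee_fin exponential_pdf_ge0.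
by rewrite integral_exponential_pdf// ltry.
Qed.

(** On [1, 2], where 0 <= ln s <= 1, the integrand is at least exp(- |k - 1|) exp(- 2). *)
Lemma gamma_integral_gt0 (k : R) : (0 < gamma_integral k)%E.
Proof.
pose c := expR (- `|k - 1|) * expR (- 2).
apply: (@lt_le_trans _ _ c%:E); first by rewrite lte_fin mulr_gt0 ?expR_gt0.
have g0 (s : R) : (0 <= (s `^ (k - 1) * expR (- s))%:E)%E.
  by rewrite lee_fin mulr_ge0 ?powR_ge0 ?expR_ge0.
have mg (D : set R) : measurable_fun D (fun s : R => (s `^ (k - 1) * expR (- s))%:E).
  exact: measurable_gamma_integrand.
apply: (@le_trans _ _ (\int[mu]_(s in `[1%R, 2%R]) ((s : R) `^ (k - 1) * expR (- s))%:E)%E).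
  rewrite -[leLHS]mule1.
  have -> : 1%E = mu `[1%R, 2%R]%classic.
    by rewrite lebesgue_measure_itv/= lte_fin ltr1n -EFinB; congr EFin; ring.
  rewrite -integral_cst//.
  apply: ge0_le_integral => //.
    by move=> s _; rewrite lee_fin mulr_ge0 ?expR_ge0.
    exact: mg.
  move=> s /=; rewrite in_itv/= => /andP[s1 s2].
  have s0 : 0 < s by rewrite (lt_le_trans ltr01).
  rewrite lee_fin ler_pM ?expR_ge0// ?ler_expR ?lerN2//.
  rewrite /powR gt_eqF// ler_expR.
  have l0 : 0 <= ln s by rewrite ln_ge0.
  have l1 : ln s <= 1.
    by have := expR_ge1Dx (ln s); rewrite lnK ?posrE//; lra.
  rewrite lerNl -mulNr (le_trans (ler_norm _))// normrM normrN (ger0_norm l0).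
  by rewrite ler_piMr.
apply: ge0_subset_integral => //; first exact: mg.
by move=> x /=; rewrite !in_itv/= andbT => /andP[x1 _]; rewrite (lt_le_trans ltr01).
Qed.

Lemma gamma_integral_scale (k c : R) : 0 < c ->
  (\int[mu]_(s in `]0%R, +oo[) ((s : R) `^ (k - 1) * expR (- (c * s)))%:E =
   (c `^ (- k))%:E * gamma_integral k)%E.
Proof.
move=> c0.
have mg : measurable_fun setT (fun s : R => (s `^ (k - 1) * expR (- s))%:E).
  exact: measurable_gamma_integrand.
have H := @ge0_integral_scale c _ c0 mg
  (fun s => ltac:(by rewrite lee_fin mulr_ge0 ?powR_ge0 ?expR_ge0)).
(* One factor compensates the power of c s, the other is the Jacobian. *)
transitivity ((c `^ (- (k - 1)))%:E * (c^-1%:E * gamma_integral k))%E; last first.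
  rewrite muleA -EFinM -(powR_inv1 (ltW c0)) -powRD; last by rewrite (gt_eqF c0) implybT.
  by congr ((c `^ _)%:E * _)%E; ring.
rewrite -H -ge0_integralZl//.
- apply: eq_integral => s /[!inE]/=; rewrite in_itv/= andbT => s0.
  rewrite -EFinM powRM ?ltW// !mulrA -powRD ?(gt_eqF c0) ?implybT// addNr powRr0 mul1r//.
- apply: measurable_funTS.
  exact: (measurableT_comp mg (mulrl_measurable c)).
- by move=> s _; rewrite lee_fin mulr_ge0 ?powR_ge0 ?expR_ge0.
- by rewrite lee_fin powR_ge0.
Qed.

Lemma nneseries_exp_coeff (x : R) : 0 <= x ->
  (\sum_(y <oo) (exp_coeff x y)%:E = (expR x)%:E)%E.
Proof.
move=> x0; rewrite /expR -EFin_lim; last exact: is_cvg_series_exp_coeff.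
by apply/congr_lim/funext => n /=; rewrite /series/= -sumEFin.
Qed.

(** Under the integral, the terms (z s)^y / y! sum to exp(z s), which changes exp(- s) into exp(- (1
    - z) s); rescaling by 1 - z concludes. *)
Lemma gamma_series (k z : R) : 0 <= z < 1 ->
  (\sum_(y <oo) ((z ^+ y / y`!%:R)%:E * gamma_integral (y%:R + k)) =
   ((1 - z) `^ (- k))%:E * gamma_integral k)%E.
Proof.
move=> /andP[z0 z1].
pose g (s : R) := s `^ (k - 1) * expR (- s).
have g0 s : 0 <= g s by rewrite mulr_ge0 ?powR_ge0 ?expR_ge0.
have mg (D : set R) : measurable_fun D g.
  by apply/measurable_EFinP; exact: measurable_gamma_integrand.
have mz (D : set R) y : measurable_fun D (fun s : R => (g s * exp_coeff (z * s) y)%:E).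
  apply/measurable_EFinP; apply: measurable_funM => //.
  apply: measurable_funM => //; apply: measurable_funX.
  exact: mulrl_measurable.
transitivity (\sum_(y <oo) \int[mu]_(s in `]0%R, +oo[) (g s * exp_coeff (z * s) y)%:E)%E.
  apply: eq_eseriesr => y _; rewrite -ge0_integralZl//.
  - apply: eq_integral => s /[!inE]/=; rewrite in_itv/= andbT => s0.
    rewrite -EFinM /g /exp_coeff/= -addrA [_ `^ (y%:R + _)]powRD; last by rewrite (gt_eqF s0) implybT.
    by rewrite powR_mulrn ?ltW// exprMn; congr EFin; ring.
  - exact: measurable_gamma_integrand.
  - by move=> s _; rewrite lee_fin mulr_ge0 ?powR_ge0 ?expR_ge0.
  - by rewrite lee_fin divr_ge0 ?exprn_ge0.
rewrite -integral_nneseries//; last 2 first.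
- by move=> y; exact: mz.
- move=> y s /=; rewrite in_itv/= andbT => s0.
  by rewrite lee_fin mulr_ge0// exp_coeff_ge0// mulr_ge0// ltW.
rewrite -gamma_integral_scale ?subr_gt0//.
apply: eq_integral => s /[!inE]/=; rewrite in_itv/= andbT => s0.
have zs : 0 <= z * s by rewrite mulr_ge0// ltW.
under eq_eseriesr do rewrite EFinM.
rewrite nneseriesZl; last by move=> y _; rewrite lee_fin exp_coeff_ge0.
rewrite nneseries_exp_coeff// -EFinM /g -mulrA -expRD.
by congr (_ * expR _)%:E; ring.
Qed.

End gamma.

(** * The negative binomial law *)

Section negative_binomial.
Context {R : realType}.
Implicit Types m k : R.

(** Finiteness of the integral ensures that the real-valued [Gamma] is not a default value. *)
Lemma GammaE k : 0 < k -> (Gamma k)%:E =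
  (\int[@lebesgue_measure R]_(s in `]0%R, +oo[) ((s : R) `^ (k - 1) * expR (- s))%:E)%E.
Proof.
move=> k0; rewrite fineK// fin_real// gamma_integral_lty// andbT.
by rewrite (lt_trans _ (gamma_integral_gt0 k)).
Qed.

Lemma Gamma_gt0 k : 0 < k -> 0 < Gamma k.
Proof. by move=> k0; rewrite -lte_fin GammaE// gamma_integral_gt0. Qed.

Section parameters.
Variables m k : R.
Hypotheses (m0 : 0 < m) (k0 : 0 < k).
Local Notation q := (nb_q m k).

Lemma nb_q_gt0 : 0 < q.
Proof. by rewrite divr_gt0// addr_gt0. Qed.

Lemma nb_q_lt1 : q < 1.
Proof. by rewrite ltr_pdivrMr ?addr_gt0// mul1r ltrDr. Qed.

Lemma nb_odds : k * q / (1 - q) = m.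
Proof.
have s0 : k + m != 0 by rewrite gt_eqF ?addr_gt0.
have -> : 1 - q = k / (k + m) by rewrite /nb_q; field.
by rewrite /nb_q; field; rewrite s0 gt_eqF.
Qed.

Lemma nb_pgf (a : R) : 0 <= a -> q * a < 1 ->
  (\sum_(y <oo) (a ^+ y * nb_pmf m k y)%:E =
   (((1 - q) / (1 - q * a)) `^ k)%:E)%E.
Proof.
move=> a0 qa; have q0 := nb_q_gt0; have q1 := nb_q_lt1.
have G0 := Gamma_gt0 k0.
have z01 : 0 <= q * a < 1 by rewrite qa mulr_ge0// ltW.
transitivity ((((1 - q) `^ k / Gamma k)%:E *
  \sum_(y <oo) (((q * a) ^+ y / y`!%:R)%:E * (Gamma (y%:R + k))%:E))%E).
  rewrite -nneseriesZl; last first.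
    move=> y _; rewrite -EFinM lee_fin mulr_ge0//.
      by rewrite divr_ge0// exprn_ge0//; case/andP: z01.
    by rewrite ltW// Gamma_gt0// ltr_wpDl.
  apply: eq_eseriesr => y _; rewrite -!EFinM /nb_pmf [(q * a) ^+ y]exprMn; congr EFin.
  rewrite invfM; ring.
under eq_eseriesr => y _ do rewrite GammaE ?ltr_wpDl//.
rewrite gamma_series// -GammaE// -!EFinM; congr EFin.
have p1 : 0 <= 1 - q by rewrite subr_ge0 ltW.
have p2 : 0 <= 1 - q * a by rewrite subr_ge0 ltW.
rewrite powRM ?invr_ge0// -[(1 - q * a)^-1]powR_inv1// -powRrM mulN1r.
by field; rewrite gt_eqF.
Qed.

(** [r] solves 1 - q r = (1 - q) / 2^(1/k), that is, the generating function equals 2 at [r]. It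
    exceeds 1 because 2^(1/k) does, so 1 / ln r is an admissible constant. *)
Lemma nb_psi1_base : let r := (1 - (1 - q) / 2 `^ k^-1) / q in
  [/\ 1 < r, q * r < 1 & ((1 - q) / (1 - q * r)) `^ k = 2].
Proof.
move=> r; have q0 := nb_q_gt0; have q1 := nb_q_lt1.
have b1 : 1 < 2 `^ k^-1 :> R.
  by rewrite /powR gt_eqF// expR_gt1 mulr_gt0 ?invr_gt0 ?ln_gt0// ltr1n.
have b0 := lt_trans ltr01 b1.
have p0 : 0 < 1 - q by rewrite subr_gt0.
have qr : q * r = 1 - (1 - q) / 2 `^ k^-1 by rewrite /r mulrC divfK// gt_eqF.
split.
- rewrite /r ltr_pdivlMr// mul1r ltrBrDl -ltrBrDr ltr_pdivrMr//.
  by rewrite ltr_pMr.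
- by rewrite qr gtrBl divr_gt0.
- rewrite qr subKr invfM invrK mulrA mulfV ?gt_eqF// mul1r.
  by rewrite -powRrM mulVf ?gt_eqF// powRr1.
Qed.

End parameters.

Section law.
Context {d : measure_display} {T : measurableType d}.
Variables (P : probability T R) (X : {RV P >-> R}) (m k : R).
Hypotheses (m0 : 0 < m) (k0 : 0 < k) (lawX : has_NB_law X m k).
Local Notation q := (nb_q m k).

(** The masses sum to 1, by the generating function at 1, so the event that [X] is not a natural
    number is negligible. *)
Lemma nb_integral (f : R -> R) : measurable_fun setT f -> (forall y, 0 <= f y) ->
  (\int[P]_x (f (X x))%:E = \sum_(y <oo) (f y%:R * nb_pmf m k y)%:E)%E.
Proof.
move=> mf f0.
pose A y := X @^-1` [set y%:R].
have mA y : measurable (A y) by exact: measurable_funPTI.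
have tA : trivIset setT A.
  apply/trivIsetP => i j _ _ ij; apply/seteqP; split=> x //= [Xi Xj].
  by move: ij; rewrite -(eqr_nat R) -Xi Xj eqxx.
have PA : P (\bigcup_y A y) = 1%E.
  rewrite measure_bigcup//.
  transitivity (\sum_(y <oo) P (A y))%E.
    by apply: eq_eseriesl => y; rewrite in_setT.
  have := nb_pgf m0 k0 ler01; rewrite mulr1 => /(_ (nb_q_lt1 m0 k0)).
  rewrite divff ?subr_eq0 ?gt_eqF ?nb_q_lt1// powR1 => <-.
  by apply: eq_eseriesr => y _; rewrite expr1n mul1r lawX.
have mU : measurable (\bigcup_y A y) by exact: bigcup_measurable.
have mfX : measurable_fun setT (fun x => (f (X x))%:E).
  by apply/measurable_EFinP; exact: measurableT_comp.
rewrite (ge0_negligible_integral (N := ~` \bigcup_y A y))//; first last.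
- by rewrite [LHS]probability_setC// PA subee.
- by move=> x _; rewrite lee_fin.
- exact: measurableC.
rewrite setDE setCK setTI ge0_integral_bigcup//; last first.
- by move=> x _; rewrite lee_fin.
- exact: measurable_funTS.
apply: eq_eseriesr => y _.
rewrite (eq_integral (cst (f y%:R)%:E)); last first.
  by move=> x /[!inE] -> .
by rewrite integral_cst// EFinM; congr (_ * _)%E; exact: lawX.
Qed.

Lemma nb_exp_moment (l : R) : q * expR l < 1 ->
  (\int[P]_x (expR (l * `|X x|))%:E = (((1 - q) / (1 - q * expR l)) `^ k)%:E)%E.
Proof.
move=> ql; rewrite (nb_integral (f := fun y => expR (l * `|y|)))//; last first.
- apply: measurableT_comp => //; apply: measurable_funM => //.
rewrite -nb_pgf ?expR_ge0//; apply: eq_eseriesr => y _.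
by rewrite ger0_norm// expRM_natr.
Qed.

(* From 1 + l |X| <= exp(l |X|); letting l tend to 0 turns the right-hand side
   into the derivative of the moment generating function. *)
Lemma nb_abs_mean_le (l : R) : 0 < l -> q * expR l < 1 ->
  (\int[P]_x `|(X x)%:E| <=
     (l^-1 * (((1 - q) / (1 - q * expR l)) `^ k - 1))%:E)%E.
Proof.
move=> l0 ql; rewrite EFinM lee_pdivlMl// EFinB.
have mX : measurable_fun setT (fun x => `|(X x)%:E|%E).
  by apply: measurableT_comp => //; exact/measurable_EFinP.
rewrite leeBrDl// -nb_exp_moment// -ge0_integralZl//; last by rewrite lee_fin ltW.
rewrite -(integral_probability_cst P 1) -ge0_integralD//.
- apply: ge0_le_integral => //.
  + by move=> x _; rewrite adde_ge0// mule_ge0// lee_fin ltW.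
  + by apply: emeasurable_funD => //; exact: measurable_funeM.
  + apply/measurable_EFinP; apply: measurableT_comp => //.
    by apply: measurable_funM => //; exact: measurableT_comp.
  + by move=> x _; rewrite /= -EFinM -EFinD lee_fin expR_ge1Dx.
- by move=> x _; rewrite mule_ge0// lee_fin ltW.
- exact: measurable_funeM.
Qed.

Lemma nb_abs_mean : (\int[P]_x `|(X x)%:E| <= m%:E)%E.
Proof.
have q0 := nb_q_gt0 m0 k0; have q1 := nb_q_lt1 m0 k0.
have q1' : 1 - q != 0 by rewrite subr_eq0 gt_eqF.
(* As [M 0 = 1], the bounds of [nb_abs_mean_le] are the difference quotients of [M] at 0; their
   limit is k q / (1 - q) = m. *)
pose M (l : R) := ((1 - q) / (1 - q * expR l)) `^ k.
have M0 : M 0 = 1 by rewrite /M expR0 mulr1 divff// powR1.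
have dM : is_derive (0 : R) 1 M m.
  have d1 : is_derive (0 : R) 1 (cst 1 - q \*: expR) (- q).
    by apply: is_derive_eq; rewrite sub0r expR0 [_ *: _]mulr1.
  set D := (X in is_derive _ _ X _) in d1.
  have D0 : D 0 = 1 - q by transitivity (1 - q * expR 0); rewrite // expR0 mulr1.
  have Dn0 : D 0 != 0 by rewrite D0.
  have d2 := is_deriveZ (1 - q) (is_deriveV Dn0 d1).
  set g := (X in is_derive _ _ X _) in d2.
  have g0 : g 0 = 1 by transitivity ((1 - q) * (D 0)^-1); rewrite // D0 mulfV.
  have d3 : is_derive (g 0) 1 (fun x : R => x `^ k) (k * g 0 `^ (k - 1)).
    by apply: is_derive1_powR; rewrite g0.
  apply: (is_derive_eq (f := M) (is_derive1_comp d3 d2)).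
  rewrite g0 powR1 D0 -[RHS](nb_odds m0 k0).
  transitivity (k * 1 * ((1 - q) * (- (1 - q) ^- 2 * - q))); first by [].
  by field.
have cv : (l^-1 * (M l - 1))%:E @[l --> (0:R)^'+] --> m%:E.
  apply: cvg_EFin; first by near=> l.
  rewrite /=; have [/cvg_dnbhs_at_right + <-] := dM.
  apply: cvg_trans; apply: near_eq_cvg; near=> l.
  by rewrite /= M0 addr0 [_%:A]mulr1.
have cq : q * expR l @[l --> (0 : R)^'+] --> q * expR 0.
  by apply: cvg_at_right_filter; apply: cvgMl_tmp; exact: continuous_expR.
apply: (cvge_to_ge cv); near=> l; apply: nb_abs_mean_le => //.
near: l; apply: (cvgr_lt _ cq).
by rewrite expR0 mulr1.
Unshelve. all: by end_near.
Qed.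

(** With C = 1 / ln r, exp(|X| / C) is r^|X|, whose expectation is exactly 2. *)
Lemma nb_psi1_norm :
  (psi1_norm P X <= ((ln ((1 - (1 - q) / 2 `^ k^-1) / q))^-1)%:E)%E.
Proof.
have [r1 qr pr] := nb_psi1_base m0 k0.
set r := (_ / q) in r1 qr pr *.
have r0 := lt_trans ltr01 r1.
have lr : 0 < ln r by rewrite ln_gt0.
apply: psi1_le; first by rewrite invr_gt0.
rewrite invrK; under eq_integral do rewrite mulrC.
by rewrite nb_exp_moment lnK ?posrE ?pr.
Qed.

Lemma nb_integrable : P.-integrable setT (EFin \o X).
Proof.
apply/integrableP; split; first exact/measurable_EFinP.
by rewrite (le_lt_trans nb_abs_mean)// ltry.
Qed.

(** An upper bound suffices: the mean enters only through the estimate of the norm of the centered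
    variable. *)
Lemma nb_mean : `|mean P X| <= m.
Proof.
rewrite -lee_fin /mean unlock.
have fX := integrable_fin_num measurableT nb_integrable.
rewrite -[`|_|%:E]/(`|(fine _)%:E|)%E fineK//.
apply: le_trans nb_abs_mean; apply: le_abse_integral => //.
exact/measurable_EFinP.
Qed.

End law.
End negative_binomial.

(** * Deduction of the three bounds from the general tail estimates *)

Unset Implicit Arguments.

Theorem corollary2 (R : realType) (d : measure_display) (T : measurableType d)
    (P : probability T R) (n : nat) (n_gt0 : (0 < n)%N)
    (Y : 'I_n -> {RV P >-> R}) (indepY : mutually_independent Y)
    (w : 'I_n -> R) (t : R) (t_ge0 : 0 <= t) :
  ((forall i, (psi1_norm P (Y i) < +oo)%E) ->
     (P [set x | t <= `|weighted_centered_sum w Y x| ]%R <=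
        bernstein_bound w
          (fun i => (fine (psi1_norm P (Y i)) + `|mean P (Y i) / ln 2|)%R) t)%E
     /\
     (let K := fun i => fine (psi1_norm P (centered P (Y i))) in
      (P [set x | 2 * Num.sqrt (2 * t * sum_weighted_sq w K)
                    + 2 * t * max_weighted w K
                  < `|weighted_centered_sum w Y x| ]%R <=
         (2 * expR (- t))%:E)%E))
  /\
  (forall mu k : 'I_n -> R,
     (forall i, 0 < mu i) -> (forall i, 0 < k i) ->
     (forall i, has_NB_law (Y i) (mu i) (k i)) ->
     (P [set x | t <= `|weighted_centered_sum w Y x| ]%R <=
        bernstein_bound w (fun i => nb_a (mu i) (k i)) t)%E).
Proof.
split=> [psiY|mu k mu0 k0 lawY].
- have intY i := psi1_norm_integrable (measurable_funPT (Y i)) (psiY i).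
  have finY i : psi1_norm P (Y i) \is a fin_num.
    by rewrite ge0_fin_numE ?psi1_norm_ge0.
  have psiE i : (psi1_norm P (Y i) <= (fine (psi1_norm P (Y i)))%:E)%E.
    by rewrite fineK.
  have cY i := psi1_norm_centered (measurable_funPT (Y i)) (psiE i).
  split.
  + apply: weighted_sum_bernstein => // i.
    by rewrite addr_ge0// fine_ge0// psi1_norm_ge0.
  + move=> K; apply: weighted_sum_tail => // i.
    (* Finiteness, needed for [fine] to return the actual norm, comes from the triangle inequality
       [cY]. *)
    have fcY : psi1_norm P (centered P (Y i)) \is a fin_num.
      by rewrite ge0_fin_numE ?psi1_norm_ge0// (le_lt_trans (cY i))// ltry.
    by rewrite /K fineK.
- have l2 : 0 < ln (2 : R) by rewrite ln_gt0// ltr1n.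
  have aK i : (psi1_norm P (centered P (Y i)) <= (nb_a (mu i) (k i))%:E)%E.
    apply: (le_trans (psi1_norm_centered (measurable_funPT (Y i))
      (nb_psi1_norm (mu0 i) (k0 i) (lawY i)))).
    rewrite lee_fin lerD2l normrM normfV (gtr0_norm l2) ler_pM2r ?invr_gt0//.
    exact: nb_mean (mu0 i) (k0 i) (lawY i).
  apply: weighted_sum_bernstein => // i.
  (* Nonnegativity of [nb_a] is read off from its bounding a psi_1 norm. *)
  + by rewrite -lee_fin (le_trans _ (aK i))// psi1_norm_ge0.
  + exact: nb_integrable (mu0 i) (k0 i) (lawY i).
Qed.
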